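(* A $3$-Hom-Lie algebra of the class $4_{3,N(2),6}$ (defined in the context), with structure constants $c(1,2,4,p),c(1,3,4,p)$, $1\le p\le4$, is multiplicative if and only if $$c(1,2,4,3)=0,\quad c(1,2,4,4)=0,\quad c(1,3,4,3)=0,\quad c(1,3,4,4)=0.$$
   Context: $\mathbb{K}$ is a field of characteristic $0$. A $3$-Hom-Lie algebra $(A,[\cdot,\cdot,\cdot],\alpha)$ is a $\mathbb{K}$-linear space $A$ with a trilinear skew-symmetric bracket and a linear map $\alpha:A\to A$ satisfying $$[\alpha(x_1),\alpha(x_2),[y_1,y_2,y_3]]=[[x_1,x_2,y_1],\alpha(y_2),\alpha(y_3)]+[\alpha(y_1),[x_1,x_2,y_2],\alpha(y_3)]+[\alpha(y_1),\alpha(y_2),[x_1,x_2,y_3]].$$ It is multiplicative if $\alpha([x,y,z])=[\alpha(x),\alpha(y),\alpha(z)]$ for all $x,y,z\in A$. The class $4_{3,N(2),6}$ consists of the $4$-dimensional $3$-Hom-Lie algebras $(A,[\cdot,\cdot,\cdot],\alpha)$ with basis $e_1,e_2,e_3,e_4$, with $\alpha(e_1)=\alpha(e_2)=0$, $\alpha(e_3)=e_2$, $\alpha(e_4)=e_3$, and with skew-symmetric bracket determined by $$[e_1,e_2,e_3]=0,\quad [e_1,e_2,e_4]=\sum_{p=1}^4 c(1,2,4,p)e_p,\quad [e_1,e_3,e_4]=\sum_{p=1}^4 c(1,3,4,p)e_p,\quad [e_2,e_3,e_4]=0,$$ where the eight structure constants $c(1,2,4,p),c(1,3,4,p)\in\mathbb{K}$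 are arbitrary parameters. *)

(* Defs.v *)
(* Library: Mathematical Components. *)
From HB Require Import structures.
From mathcomp Require Import all_boot perm all_algebra.

Set Implicit Arguments.
Unset Strict Implicit.
Unset Printing Implicit Defensive.

Import GRing.Theory.
Local Open Scope ring_scope.

Section HomLie3.

Variables (K : fieldType) (A : lmodType K).

Definition trilinear (br : A -> A -> A -> A) : Prop :=
  [/\ forall y z, linear (fun x => br x y z),
      forall x z, linear (fun y => br x y z)
    & forall x y, linear (fun z => br x y z)].

Definition skew_symmetric (br : A -> A -> A -> A) : Prop :=
  forall (x : 'I_3 -> A) (s : 'S_3),
    br (x (s (inord 0))) (x (s (inord 1))) (x (s (inord 2)))
    = ((-1) ^+ s : K) *: br (x (inord 0)) (x (inord 1)) (x (inord 2)).

Definition hom_nambu_identity (br : A -> A -> A -> A) (alpha : A -> A) : Prop :=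
  forall x1 x2 y1 y2 y3,
    br (alpha x1) (alpha x2) (br y1 y2 y3)
    = br (br x1 x2 y1) (alpha y2) (alpha y3)
      + br (alpha y1) (br x1 x2 y2) (alpha y3)
      + br (alpha y1) (alpha y2) (br x1 x2 y3).

Record homLie3 := HomLie3 {
  bracket : A -> A -> A -> A;
  twist : {linear A -> A};
  bracket_trilinear : trilinear bracket;
  bracket_skew : skew_symmetric bracket;
  bracket_hom_nambu : hom_nambu_identity bracket twist
}.

Definition is_multiplicative (L : homLie3) : Prop :=
  forall x y z,
    twist L (bracket L x y z)
    = bracket L (twist L x) (twist L y) (twist L z).

End HomLie3.

(* The indices 1, 2, 3, 4 of a basis e_1, ..., e_4, as elements of 'I_4, whose
   underlying values are 0, 1, 2, 3. *)
Definition i1 : 'I_4 := inord 0.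
Definition i2 : 'I_4 := inord 1.
Definition i3 : 'I_4 := inord 2.
Definition i4 : 'I_4 := inord 3.

(* L belongs to the class 4_{3,N(2),6}, as witnessed by the basis e and the
   structure constants c i j k p; only the eight values c i1 i2 i4 p and
   c i1 i3 i4 p are used, and they are unconstrained. *)
Record class_4_3N2_6 (K : fieldType) (A : vectType K) (L : homLie3 A)
    (e : 4.-tuple A) (c : 'I_4 -> 'I_4 -> 'I_4 -> 'I_4 -> K) : Prop := {
  class_basis : basis_of fullv e;
  class_twist1 : twist L (tnth e i1) = 0;
  class_twist2 : twist L (tnth e i2) = 0;
  class_twist3 : twist L (tnth e i3) = tnth e i2;
  class_twist4 : twist L (tnth e i4) = tnth e i3;
  class_bracket123 : bracket L (tnth e i1) (tnth e i2) (tnth e i3) = 0;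
  class_bracket124 : bracket L (tnth e i1) (tnth e i2) (tnth e i4)
                     = \sum_(p < 4) c i1 i2 i4 p *: tnth e p;
  class_bracket134 : bracket L (tnth e i1) (tnth e i3) (tnth e i4)
                     = \sum_(p < 4) c i1 i3 i4 p *: tnth e p;
  class_bracket234 : bracket L (tnth e i2) (tnth e i3) (tnth e i4) = 0
}.

(* Main.v *)
(** The defect [D x y z = alpha [x, y, z] - [alpha x, alpha y, alpha z]] is
    trilinear and skew-symmetric, so it is zero iff it vanishes on the four
    triples [e_i, e_j, e_k] with [i < j < k]. Each of these triples contains
    [e_1] or [e_2], which [alpha] kills, so there [D] is [alpha [e_i, e_j, e_k]].
    As [alpha] sends [\sum_p c_p e_p] to [c_3 e_2 + c_4 e_3], the vanishing of
    [D] amounts to that of the coefficients on [e_3] and [e_4]. *)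
Require Import Defs.
From HB Require Import structures.
From mathcomp Require Import all_boot perm all_algebra.

Set Implicit Arguments.
Unset Strict Implicit.
Unset Printing Implicit Defensive.

Import GRing.Theory.
Local Open Scope ring_scope.

(** Stated for a bare function, so that it applies directly to each slot of a trilinear map with the
    other two arguments fixed. *)
Lemma linear_basis_eq0 (K : fieldType) (A : vectType K) (n : nat)
    (e : n.-tuple A) (f : A -> A) :
  basis_of fullv e -> linear f -> (forall i, f (tnth e i) = 0) ->
  forall v, f v = 0.
Proof.
move=> be lf fe0 v; rewrite (coord_basis be (memvf v)).
(* The scalar -1 turns linearity at 0 into [f 0 = - f 0 + f 0]. *)
have f0 : f 0 = 0 by have := lf (-1) 0 0; rewrite scaler0 addr0 scaleN1r addNr.
have fD u w : f u = 0 -> f w = 0 -> f (u + w) = 0.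
  by move=> fu fw; rewrite -[u]scale1r lf fu fw scaler0 addr0.
elim/big_ind: _ => // i _.
by rewrite -[_ *: _]addr0 lf f0 -tnth_nth fe0 scaler0 addr0.
Qed.

Section SkewSymmetric.

Variables (K : fieldType) (A : lmodType K) (br : A -> A -> A -> A).
Hypothesis br_skew : skew_symmetric br.

Lemma skew_swap12 x y z : br y x z = - br x y z.
Proof.
have := br_skew (tnth [tuple x; y; z]) (tperm (inord 0) (inord 1)).
by rewrite odd_tperm tpermL tpermR tpermD -?val_eqE /= ?inordK // expr1 scaleN1r
  !(tnth_nth 0) !inordK.
Qed.

Lemma skew_swap23 x y z : br x z y = - br x y z.
Proof.
have := br_skew (tnth [tuple x; y; z]) (tperm (inord 1) (inord 2)).
by rewrite odd_tperm tpermL tpermR tpermD -?val_eqE /= ?inordK // expr1 scaleN1r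
  !(tnth_nth 0) !inordK.
Qed.

Hypothesis charK : [pchar K] =i pred0.

(** Characteristic 0 enters here: the hypothesis says 2v = 0, and 2 is nonzero in [K]. *)
Lemma eq_opp0 (v : A) : v = - v -> v = 0.
Proof.
have two_neq0 : 2%:R != 0 :> K by have := charK 2; rewrite !inE /= => ->.
move/eqP; rewrite -subr_eq0 opprK -mulr2n -scaler_nat scaler_eq0.
by rewrite (negPf two_neq0) => /eqP.
Qed.

(** Insertion sort on the indices: each adjacent swap only changes the sign, and a repeated index
    gives a vector equal to its opposite. *)
Lemma skew_increasing_eq0 n (e : 'I_n -> A) :
    (forall i j k : 'I_n, (i < j)%N -> (j < k)%N -> br (e i) (e j) (e k) = 0) ->
  forall i j k, br (e i) (e j) (e k) = 0.
Proof.
move=> e0.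
have br0l x z : br x x z = 0 by apply: eq_opp0; exact: skew_swap12.
have br0r x z : br x z z = 0 by apply: eq_opp0; exact: skew_swap23.
(* With the first two indices in order, [k] is inserted by at most two swaps. *)
have e0l (i j k : 'I_n) : (i < j)%N -> br (e i) (e j) (e k) = 0.
  move=> ltij; case: (ltngtP j k) => [|ltkj|/val_inj <-]; first exact: e0.
    rewrite skew_swap23; case: (ltngtP i k) => [ltik|ltki|/val_inj <-].
    - by rewrite e0 ?oppr0.
    - by rewrite skew_swap12 e0 ?oppr0.
    - by rewrite br0l oppr0.
  exact: br0r.
move=> i j k; case: (ltngtP i j) => [|ltji|/val_inj <-]; first exact: e0l.
  by rewrite skew_swap12 e0l ?oppr0.
exact: br0l.
Qed.

End SkewSymmetric.

Lemma trilinear_skew_eq0 (K : fieldType) (charK : [pchar K] =i pred0)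
    (A : vectType K) n (e : n.-tuple A) (br : A -> A -> A -> A) :
    basis_of fullv e -> trilinear br -> skew_symmetric br ->
    (forall i j k : 'I_n, (i < j)%N -> (j < k)%N ->
       br (tnth e i) (tnth e j) (tnth e k) = 0) ->
  forall x y z, br x y z = 0.
Proof.
move=> be [lin1 lin2 lin3] skew e0 x y z.
apply: (linear_basis_eq0 be (lin1 y z)) => i.
apply: (linear_basis_eq0 be (lin2 (tnth e i) z)) => j.
apply: (linear_basis_eq0 be (lin3 (tnth e i) (tnth e j))) => k.
exact: (skew_increasing_eq0 skew charK e0).
Qed.

Section MultiplicativityDefect.

Variables (K : fieldType) (A : lmodType K) (L : homLie3 A).

Definition mult_defect x y z :=
  twist L (bracket L x y z) - bracket L (twist L x) (twist L y) (twist L z).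

Lemma mult_defect_trilinear : trilinear mult_defect.
Proof.
have [lin1 lin2 lin3] := bracket_trilinear L.
split=> [y z | x z | x y] a u v; rewrite /mult_defect linearP.
(* Both brackets are expanded; [addrACA] then regroups the four terms into the defects at [u] and
   [v]. *)
- by rewrite lin1 (lin1 (twist L y)) linearP scalerBr opprD addrACA.
- by rewrite lin2 (lin2 (twist L x)) linearP scalerBr opprD addrACA.
- by rewrite lin3 (lin3 (twist L x)) linearP scalerBr opprD addrACA.
Qed.

Lemma mult_defect_skew : skew_symmetric mult_defect.
Proof.
move=> x s; rewrite /mult_defect (bracket_skew L) linearZ.
(* The twisted triple is permuted by the same [s], so both terms acquire the same sign. *)
by rewrite (bracket_skew L (fun i => twist L (x i))) scalerBr.
Qed.

End MultiplicativityDefect.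

Lemma I4_increasing (P : 'I_4 -> 'I_4 -> 'I_4 -> Prop) :
    P i1 i2 i3 -> P i1 i2 i4 -> P i1 i3 i4 -> P i2 i3 i4 ->
  forall i j k : 'I_4, (i < j)%N -> (j < k)%N -> P i j k.
Proof.
move=> P123 P124 P134 P234 i j k.
(* Once indices are written as [inord] of their values, case analysis leaves the four increasing
   triples, which match the hypotheses by unfolding; all others contradict an inequality. *)
rewrite -[i]inord_val -[j]inord_val -[k]inord_val !inordK //.
by case: i j k => [[|[|[|[|i]]]] ?] [[|[|[|[|j]]]] ?] [[|[|[|[|k]]]] ?].
Qed.

Section Class.

Variables (K : fieldType) (A : vectType K) (L : homLie3 A).
Variables (e : 4.-tuple A) (c : 'I_4 -> 'I_4 -> 'I_4 -> 'I_4 -> K).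
Hypothesis clL : class_4_3N2_6 L e c.

Lemma twist_comb (d : 'I_4 -> K) :
  twist L (\sum_(p < 4) d p *: tnth e p)
  = d i3 *: tnth e i2 + d i4 *: tnth e i3.
Proof.
have -> : \sum_(p < 4) d p *: tnth e p
    = d i1 *: tnth e i1 + d i2 *: tnth e i2
      + d i3 *: tnth e i3 + d i4 *: tnth e i4.
  rewrite !big_ord_recr big_ord0 /= add0r.
  by do ![congr (_ + _)]; congr (d _ *: tnth e _);
    apply: val_inj; rewrite /= inordK.
rewrite !linearD !linearZ /= (class_twist1 clL) (class_twist2 clL).
by rewrite (class_twist3 clL) (class_twist4 clL) !scaler0 !add0r.
Qed.

Lemma comb23_eq0 a b :
  a *: tnth e i2 + b *: tnth e i3 = 0 -> a = 0 /\ b = 0.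
Proof.
have /freeP fe := basis_free (class_basis clL).
(* Extending the two coefficients by zero gives a full family to which freeness of the basis
   applies. *)
pose d (p : 'I_4) := if p == i2 then a else if p == i3 then b else 0.
have ne23 : i3 != i2 by rewrite -val_eqE /= !inordK.
move=> ab0; have d0 : forall p, d p = 0.
  apply: fe; rewrite -[RHS]ab0 (bigD1 i2) //= (bigD1 i3) //= big1 => [|p].
    by rewrite addr0 /d !eqxx (negPf ne23) -!tnth_nth.
  by case/andP=> /negPf p2 /negPf p3; rewrite /d p2 p3 scale0r.
by have := d0 i2; have := d0 i3; rewrite /d !eqxx (negPf ne23).
Qed.

Lemma bracket0l y z : bracket L 0 y z = 0.
Proof.
have [lin1 _ _] := bracket_trilinear L.
by have := lin1 y z (-1) 0 0; rewrite scaler0 addr0 scaleN1r addNr.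
Qed.

Lemma mult_defect_e1 y z :
  mult_defect L (tnth e i1) y z = twist L (bracket L (tnth e i1) y z).
Proof. by rewrite /mult_defect (class_twist1 clL) bracket0l subr0. Qed.

Lemma mult_defect_e2 y z :
  mult_defect L (tnth e i2) y z = twist L (bracket L (tnth e i2) y z).
Proof. by rewrite /mult_defect (class_twist2 clL) bracket0l subr0. Qed.

End Class.

Theorem corollary4 (K : fieldType) (charK : [pchar K] =i pred0)
    (A : vectType K) (L : homLie3 A) (e : 4.-tuple A)
    (c : 'I_4 -> 'I_4 -> 'I_4 -> 'I_4 -> K)
    (clL : class_4_3N2_6 L e c) :
  is_multiplicative L <->
  [/\ c i1 i2 i4 i3 = 0, c i1 i2 i4 i4 = 0,
      c i1 i3 i4 i3 = 0 & c i1 i3 i4 i4 = 0].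
Proof.
split=> [mulL | [c1243 c1244 c1343 c1344] x y z].
  have D0 x y z : mult_defect L x y z = 0 by rewrite /mult_defect mulL subrr.
  (* Each of the two brackets with free constants yields two of the four equations. *)
  have := D0 (tnth e i1) (tnth e i2) (tnth e i4).
  rewrite (mult_defect_e1 clL) (class_bracket124 clL) (twist_comb clL).
  case/(comb23_eq0 clL) => -> ->.
  have := D0 (tnth e i1) (tnth e i3) (tnth e i4).
  rewrite (mult_defect_e1 clL) (class_bracket134 clL) (twist_comb clL).
  by case/(comb23_eq0 clL) => -> ->.
apply/eqP; rewrite -subr_eq0; apply/eqP; move: x y z.
apply: (trilinear_skew_eq0 charK (class_basis clL)
          (mult_defect_trilinear L) (mult_defect_skew L)).
apply: I4_increasing.
- by rewrite (mult_defect_e1 clL) (class_bracket123 clL) linear0.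
- rewrite (mult_defect_e1 clL) (class_bracket124 clL) (twist_comb clL).
  by rewrite c1243 c1244 !scale0r addr0.
- rewrite (mult_defect_e1 clL) (class_bracket134 clL) (twist_comb clL).
  by rewrite c1343 c1344 !scale0r addr0.
- by rewrite (mult_defect_e2 clL) (class_bracket234 clL) linear0.
Qed.
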